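(* Let $M$ be a matroid with rank function $r$. Every minimal $M$-cover $F$ satisfies $|F|>r\left(\bigcup F\right)$.
   Context: Let $M$ be a matroid on a finite ground set $E$. A collection $F$ of subsets of $E$ is an $M$-cover if no basis of $M$ intersects all sets in $F$. An $M$-cover is minimal if no proper subcollection of it is an $M$-cover. $\bigcup F$ denotes the union of the sets in $F$. *)

(* Defs.v *)
From mathcomp Require Import all_boot.

Set Implicit Arguments.
Unset Strict Implicit.
Unset Printing Implicit Defensive.

(* A matroid whose ground set is the whole of the finite type E. *)
Record matroid (E : finType) := Matroid {
  indep : {set {set E}};
  indep_set0 : set0 \in indep;
  indep_subset : forall I J : {set E}, I \subset J -> J \in indep -> I \in indep;
  indep_augment : forall I J : {set E}, I \in indep -> J \in indep ->
    #|I| < #|J| -> exists2 x, x \in J :\: I & x |: I \in indep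
}.

Section MatroidDefs.
Variables (E : finType) (M : matroid E).

Definition basis (B : {set E}) : bool := maxset [pred I | I \in indep M] B.

Definition rank (A : {set E}) : nat :=
  \max_(I in indep M | I \subset A) #|I|.

Definition Mcover (F : {set {set E}}) : bool :=
  ~~ [exists B : {set E}, basis B && [forall A in F, B :&: A != set0]].

Definition minimal_Mcover (F : {set {set E}}) : bool := minset Mcover F.

End MatroidDefs.

(* Main.v *)
Require Import Defs.
From mathcomp Require Import all_boot.
From mathcomp Require Import zify.

(** A subfamily [G] of an [M]-cover [F], maximal subject to being empty or
    satisfying [rank M (cover G) < #|G|], leaves a remainder [F :\: G]
    satisfying Rado's condition in the contraction of [M] by [cover G]. If [G]
    were a proper subfamily, minimality of [F] would give an independent subset
    of [cover G] meeting all of [G]; Rado's theorem in the contraction would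
    extend it to an independent set meeting all of [F]. Hence [G = F]. *)

Section Matroid.
Set Implicit Arguments.
Unset Strict Implicit.

Variables (E : finType) (M : matroid E).
Implicit Types (I J X A : {set E}) (F G H K : {set {set E}}).

Lemma indep_card_le_rank I A :
  I \in indep M -> I \subset A -> #|I| <= rank M A.
Proof.
by move=> iI sIA; apply: (bigmax_sup I) => //; rewrite iI sIA.
Qed.

Lemma rank_le_add1 x X : rank M (x |: X) <= (rank M X).+1.
Proof.
apply/bigmax_leqP => I /andP[iI sI].
have h : #|I :\ x| <= rank M X.
  apply: indep_card_le_rank; first exact: indep_subset (subD1set I x) iI.
  by rewrite subDset.
by rewrite (cardsD1 x I); case: (x \in I) => /=; rewrite ?add1n ?add0n // ltnW.
Qed.

Lemma indep_extend_lt_rank I X : I \in indep M -> #|I| < rank M X ->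
  exists x, [/\ x \in X, x \notin I & x |: I \in indep M].
Proof.
move=> iI lt.
have [J /andP[iJ sJ] eqJ] : {J | (J \in indep M) && (J \subset X) &
    rank M X = #|J|}.
  apply: eq_bigmax_cond; apply/card_gt0P; exists set0.
  by rewrite unfold_in sub0set indep_set0.
rewrite eqJ in lt.
have [x] := indep_augment iI iJ lt.
rewrite inE => /andP[xI xJ] iU; exists x; split=> //.
exact: subsetP sJ x xJ.
Qed.

Lemma indep_extend_rank I X : I \in indep M -> I \subset X ->
  exists J, [/\ I \subset J, J \subset X, J \in indep M & #|J| = rank M X].
Proof.
move=> iI sI.
have [|J /maxsetP[/andP[iJ sJ] maxJ] sIJ] :=
  @maxset_exists _ [pred J : {set E} | (J \in indep M) && (J \subset X)] I.
  by rewrite /= iI sI.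
exists J; split=> //; apply/eqP; rewrite eqn_leq indep_card_le_rank //= leqNgt.
apply/negP=> /(indep_extend_lt_rank iJ) [x [xX xJ iU]].
have := maxJ (x |: J); rewrite /= iU subUset sub1set xX sJ => /(_ isT).
rewrite subsetUr => /(_ isT) eqJ.
by move: xJ; rewrite -{1}eqJ setU11.
Qed.

(** Extend [I] to a basis: a member of [F] missed by the basis is missed by [I]. *)
Lemma Mcover_missed I F : Mcover M F -> I \in indep M ->
  exists2 A, A \in F & I :&: A = set0.
Proof.
move=> cF iI.
have [B bB sIB] := @maxset_exists _ [pred J | J \in indep M] I iI.
move: cF; rewrite /Mcover negb_exists => /forallP/(_ B).
rewrite negb_and /basis bB /= => /forall_inPn [A AF].
rewrite negbK => /eqP BA; exists A => //.
by apply/eqP; rewrite -subset0 -BA setSI.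
Qed.

Lemma coverU G K : cover (G :|: K) = cover G :|: cover K.
Proof. exact: bigcup_setU. Qed.

(** Rado's theorem for the contraction of [M] by [X], proved as Halmos and
    Vaughan prove Hall's theorem: split along a tight proper subfamily if there
    is one, and otherwise represent an arbitrary member first. *)
Lemma rado_contraction X H I :
  (forall K, K \subset H -> rank M X + #|K| <= rank M (X :|: cover K)) ->
  I \in indep M -> I \subset X ->
  exists2 J : {set E}, I \subset J /\ J \in indep M & {in H, forall A, J :&: A != set0}.
Proof.
have [n] := ubnP #|H|; elim: n => // n IHn in X H I *.
rewrite ltnS => leHn rado iI sI.
have [-> | [A AH]] := set_0Vmem H.
  by exists I => // A; rewrite inE.
case: (boolP [exists K : {set {set E}},
    [&& K \proper H, K != set0 & rank M (X :|: cover K) == rank M X + #|K|]]).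
- case/existsP=> K /and3P[prK K0 /eqP tight].
  have sKH := proper_sub prK.
  have ltK : #|K| < n by apply: leq_trans (proper_card prK) leHn.
  have [L sL|J [sIJ iJ] hJ] := IHn X K I ltK _ iI sI.
    exact: rado (subset_trans sL sKH).
  (* The trace of [J] on [X :|: cover K] still meets every member of [K], and it can seed the
     induction over this larger set. *)
  have iJ' : J :&: (X :|: cover K) \in indep M.
    exact: indep_subset (subsetIl _ _) iJ.
  have ltD : #|H :\: K| < n.
    have := cardsID K H; rewrite (setIidPr sKH).
    by move: K0; rewrite -card_gt0; lia.
  have [L sL||J2 [sJ2 iJ2] hJ2] := IHn (X :|: cover K) (H :\: K) _ ltD _ iJ'.
  + have [sLH dLK] := subsetDP sL.
    (* Tightness of [K] turns the condition for [L] over [X :|: cover K] into the condition for the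
       disjoint union [K :|: L] over [X]. *)
    rewrite tight -setUA -coverU -addnA.
    have := rado (K :|: L); rewrite subUset sKH sLH => /(_ isT).
    by rewrite cardsU setIC (disjoint_setI0 dLK) cards0 subn0.
  + exact: subsetIr.
  exists J2.
    split=> //; apply: subset_trans sJ2.
    by rewrite subsetI sIJ (subset_trans sI) ?subsetUl.
  move=> B BH; have [BK | BK] := boolP (B \in K); last first.
    by apply: hJ2; rewrite inE BK.
  have /set0Pn[x] := hJ B BK; rewrite inE => /andP[xJ xB].
  apply/set0Pn; exists x; rewrite inE xB andbT; apply: (subsetP sJ2).
  rewrite !inE xJ; apply/orP; right.
  by apply/bigcupP; exists B.
- move/existsPn=> slack.
  (* As [I1] has full rank in [X], an element that augments it lies outside [X], hence in [A]. *)
  have [I1 [sI1 sI1X iI1 cI1]] := indep_extend_rank iI sI.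
  have [x [xXA xI1 iU]] : exists x,
      [/\ x \in X :|: cover [set A], x \notin I1 & x |: I1 \in indep M].
    apply: indep_extend_lt_rank => //; rewrite cI1.
    by have := rado [set A]; rewrite sub1set AH cards1 addn1; apply.
  have xA : x \in A.
    move: xXA; rewrite /cover big_set1 inE => /orP[xX | //].
    have := @indep_card_le_rank _ X iU.
    rewrite subUset sub1set xX sI1X cardsU1 xI1 cI1 /= => /(_ isT).
    by rewrite add1n ltnn.
  have ltA : #|H :\ A| < n by move: leHn; rewrite (cardsD1 A H) AH.
  have [K sK||J [sJ iJ] hJ] := IHn (x |: X) (H :\ A) (x |: I1) ltA _ iU.
  + have [-> | K0] := eqVneq K set0.
      by rewrite cards0 addn0 /cover big_set0 setU0.
    have prK : K \proper H := sub_proper_trans sK (properD1 AH).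
    (* No proper nonempty subfamily is tight, so the condition for [K] over [X] is strict; this
       absorbs the rank that [x] may add to [X]. *)
    have := slack K; rewrite prK K0 /= => neq.
    have le : rank M (X :|: cover K) <= rank M (x |: X :|: cover K).
      apply/bigmax_leqP => L /andP[iL sL]; apply: indep_card_le_rank => //.
      by rewrite -setUA (subset_trans sL) ?subsetUr.
    apply: leq_trans le; apply: leq_trans (leq_add (rank_le_add1 x X) (leqnn _)) _.
    by rewrite addSn ltn_neqAle eq_sym neq rado ?proper_sub.
  + exact: setUS.
  have [xJ sI1J] : x \in J /\ I1 \subset J.
    by apply/andP; rewrite -sub1set -subUset.
  exists J; first by split=> //; apply: subset_trans sI1 sI1J.
  move=> B BH; have [-> | BA] := eqVneq B A.
    by apply/set0Pn; exists x; rewrite inE xJ.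
  by apply: hJ; rewrite !inE BA.
Qed.

End Matroid.

Theorem theorem3p11 (E : finType) (M : matroid E) (F : {set {set E}}) :
  minimal_Mcover M F -> rank M (cover F) < #|F|.
Proof.
case/minsetP=> cF minF; apply: contraT => /negPf ltF.
pose deficient := [pred G : {set {set E}} |
  (G \subset F) && ((G == set0) || (rank M (cover G) < #|G|))].
have [|G /maxsetP[/andP[sGF defG] maxG] _] := @maxset_exists _ deficient set0.
  by rewrite /= sub0set eqxx.
have leG : rank M (cover G) <= #|G|.
  case/orP: defG => [/eqP-> | /ltnW //].
  rewrite /cover big_set0 cards0; apply/bigmax_leqP => I /andP[_].
  by rewrite subset0 => /eqP->; rewrite cards0.
have [I iI hI] : exists2 I, I \in indep M & {in G, forall A, I :&: A != set0}.
  have [G0 | G0] := eqVneq G set0.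
    by exists set0; [exact: indep_set0 | move=> A; rewrite G0 inE].
  have [eqGF | neqGF] := eqVneq G F.
    by move: defG; rewrite (negPf G0) /= eqGF ltF.
  have : ~~ Mcover M G.
    by apply/negP=> cG; case/eqP: neqGF; apply: minF.
  rewrite negbK => /existsP[B /andP[/maxsetP[iB _] /forall_inP hB]].
  by exists B.
have iI' : I :&: cover G \in indep M by apply: indep_subset (subsetIl _ _) iI.
have [K sK | | J [sJ iJ] hJ] := @rado_contraction _ M (cover G) (F :\: G) _ _ iI'.
- have [-> | K0] := eqVneq K set0.
    by rewrite cards0 addn0 /cover big_set0 setU0.
  have [sKF dKG] := subsetDP sK.
  have cardGK : #|G :|: K| = #|G| + #|K|.
    by rewrite cardsU setIC (disjoint_setI0 dKG) cards0 subn0.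
  (* If the second inequality failed, [G :|: K] would be deficient, against the maximality of
     [G]. *)
  rewrite -coverU; apply: leq_trans (_ : #|G :|: K| <= _).
    by rewrite cardGK leq_add2r.
  rewrite leqNgt; apply/negP=> ltGK.
  have := maxG (G :|: K); rewrite /= subUset sGF sKF ltGK orbT subsetUl.
  move=> /(_ isT isT) eqG; move: K0; rewrite -card_gt0.
  by move: cardGK; rewrite eqG; lia.
- exact: subsetIr.
(* Yet [J] meets all of [F]: [hJ] covers the members outside [G], and [J] contains [I :&: cover G],
   which meets those in [G]. *)
have [A AF JA] := Mcover_missed cF iJ.
have [AG | AG] := boolP (A \in G); last first.
  by have := hJ A; rewrite inE AG AF JA eqxx => /(_ isT).
have /set0Pn[x] := hI A AG; rewrite inE => /andP[xI xA].
have : x \in J :&: A.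
  rewrite inE xA andbT; apply: (subsetP sJ); rewrite inE xI.
  by apply/bigcupP; exists A.
by rewrite JA inE.
Qed.
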